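(* Let $\mathcal{H}$ be a complex Hilbert space. If $T\in \boldsymbol{B}(\mathcal{H})$ is a CPD operator which is invertible in $\boldsymbol{B}(\mathcal{H})$, then its inverse $T^{-1}$ is CPD.
   Context: $\boldsymbol{B}(\mathcal{H})$ is the algebra of bounded linear operators on $\mathcal{H}$. A real sequence $\{\gamma_n\}_{n=0}^\infty$ is conditionally positive definite (CPD) if $\sum_{i,j=0}^k \gamma_{i+j}\lambda_i\bar\lambda_j\geq 0$ for all finite complex sequences $\lambda_0,\ldots,\lambda_k$ with $\sum_{i=0}^k\lambda_i=0$. An operator $T\in\boldsymbol{B}(\mathcal{H})$ is CPD if the sequence $\{\|T^nh\|^2\}_{n=0}^\infty$ is CPD for every $h\in\mathcal{H}$. *)

(* Defs.v *)
From HB Require Import structures.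
From mathcomp Require Import all_boot all_order all_algebra complex.
From mathcomp Require Import all_classical all_reals all_analysis.

Set Implicit Arguments.
Unset Strict Implicit.
Unset Printing Implicit Defensive.

Import Order.TTheory GRing.Theory Num.Theory.
Import numFieldNormedType.Exports.

Local Open Scope classical_set_scope.
Local Open Scope ring_scope.
Local Open Scope complex_scope.

(* The scalar field is R[i], so the norm of a normed module over it is R[i]-valued,
   with values in the nonnegative reals of R[i].  The inner product [hdot] is
   linear in its first argument and conjugate-linear in the second. *)
HB.mixin Record CompleteNormedModule_isHilbert (R : realType) (H : Type)
    of CompleteNormedModule R[i] H := {
  hdot : {dot H for (@Num.conj R[i])} ;
  hdot_norm : forall x : H, `|x| ^+ 2 = hdot x x
}.

#[short(type="hilbertType")]
HB.structure Definition Hilbert (R : realType) :=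
  { H of CompleteNormedModule R[i] H & CompleteNormedModule_isHilbert R H }.

(* By [linear_boundedP], this is the existence of M such that
   `|T x| <= M * `|x| for all x. *)
Definition bounded_operator (R : realType) (H : hilbertType R)
    (T : {linear H -> H}) : Prop :=
  bounded_near T (nbhs (0 : H)).

(* In R[i], [0 <= z] means that z is real and nonnegative. *)
Definition cpd (R : realType) (gamma : nat -> R) : Prop :=
  forall (k : nat) (l : 'I_k.+1 -> R[i]),
    \sum_(i < k.+1) l i = 0 ->
    0 <= \sum_(i < k.+1) \sum_(j < k.+1) (gamma (i + j)%N)%:C * l i * (l j)^*.

Definition cpd_operator (R : realType) (H : hilbertType R)
    (T : {linear H -> H}) : Prop :=
  forall h : H, cpd (fun n => complex.Re `|iter n T h| ^+ 2).

(* Main.v *)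
Require Import Defs.
From mathcomp Require Import all_boot all_order all_algebra complex.
From mathcomp Require Import all_classical all_reals all_analysis.

(* With g := T^(-2k) h one has T^(-(i+j)) h = T^((k-i)+(k-j)) g for i, j <= k, so
   reversing the coefficients turns the quadratic form of order k of T^-1 at h
   into that of T at g. *)

Lemma iter_cancel (A : Type) (f g : A -> A) (m n : nat) (x : A) :
  cancel g f -> (m <= n)%N -> iter (n - m) f (iter n g x) = iter m g x.
Proof.
move=> gK mn; have -> : iter n g x = iter (n - m) g (iter m g x).
  by rewrite -iterD subnK.
by elim: (n - m)%N (iter m g x) => // d IH y; rewrite iterSr /= gK IH.
Qed.

Theorem proposition1p2p1 (R : realType) (H : hilbertType R)
    (T Tinv : {linear H -> H})
    (T_bounded : bounded_operator T)
    (T_cpd : cpd_operator T)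
    (Tinv_bounded : bounded_operator Tinv)
    (TinvT : cancel T Tinv)
    (TTinv : cancel Tinv T) :
  cpd_operator Tinv.
Proof.
move=> h k l suml0.
(* Reversal permutes the coefficients, so the zero-sum constraint survives. *)
have sumrev0 : (\sum_(i < k.+1) l (rev_ord i) = 0)%R.
  by rewrite (reindex_inj rev_ord_inj) -[RHS]suml0; apply: eq_bigr => i _; rewrite rev_ordK.
(* [k + k] is the largest value of [i + j], so each power of [Tinv] that occurs at [h] is a
   nonnegative power of [T] at this vector. *)
have := T_cpd (iter (k + k) Tinv h) k (fun i => l (rev_ord i)) sumrev0.
congr (is_true (Order.le _ _)).
(* Reversing both indices in the form of [Tinv] makes the coefficients agree term by term; only the
   norms remain to be matched. *)
rewrite [RHS](reindex_inj rev_ord_inj); apply: eq_bigr => i _.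
rewrite [RHS](reindex_inj rev_ord_inj); apply: eq_bigr => j _.
(* These bounds keep the truncated differences [k - i] and [k - j] exact. *)
have ik : (i <= k)%N by rewrite -ltnS.
have jk : (j <= k)%N by rewrite -ltnS.
have -> : (i + j = (k + k) - (rev_ord i + rev_ord j))%N.
  by rewrite /= !subSS subnDA -addnBAC ?leq_subr // subKn // -addnBA ?leq_subr // subKn.
by rewrite iter_cancel // leq_add //= subSS leq_subr.
Qed.
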